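(* Consider the system with state $x=(v_{dc},i_{dq},v_{dq})\in\mathbb{R}\times\mathbb{R}^2\times\mathbb{R}^2$, $$C_{dc}\dot v_{dc}=-G_{dc}v_{dc}+i_{dc}-\tfrac{\mu}{2}\mathbf{e}_2^\top i_{dq},$$ $$L\,\dot i_{dq}=-R\,i_{dq}-v_{dc}\,\eta L\boldsymbol{J}\,i_{dq}+\tfrac{\mu}{2}\mathbf{e}_2v_{dc}-v_{dq},$$ $$C\,\dot v_{dq}=-G\,v_{dq}-v_{dc}\,\eta C\boldsymbol{J}\,v_{dq}-i_{l,dq}+i_{dq},$$ together with the DC-side proportional controller $i_{dc}=i_{dc,\mathrm{ref}}-K_p(v_{dc}-v_{dc,\mathrm{ref}})$ and the AC-side load $i_{l,dq}=(G_l\boldsymbol{I}+B_l\boldsymbol{J})v_{dq}+s_{l,dq}$. Assume there exists a steady state $x^*=(v_{dc}^*,i_{dq}^*,v_{dq}^* )$ satisfying $$\frac{C^2\lVert v_{dq}^*\rVert^2}{4(G+G_l)}+\frac{L^2\lVert i_{dq}^*\rVert^2}{4R}<\frac{G_{dc}+K_p}{\eta^2}.$$ Then, for stationary loads $s_{l,dq}=s_{l,dq}^*$ (constant), the steady state $x^*$ is unique and globally asymptotically stable.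
   Context: Here $\boldsymbol{I}$ is the $2\times2$ identity, $\boldsymbol{J}=\begin{bmatrix}0&-1\\1&0\end{bmatrix}$, $\mathbf{e}_2=\begin{bmatrix}0\\1\end{bmatrix}$, and $\lVert\cdot\rVert$ is the Euclidean norm. The parameters $C_{dc},G_{dc},L,R,C,G,\eta,G_l,B_l,K_p,i_{dc,\mathrm{ref}},v_{dc,\mathrm{ref}}>0$ and $\mu\in[0,1]$ are constants. The system is a three-phase DC/AC converter in a rotating $dq$-frame with angle $\theta$, $\dot\theta=\omega:=\eta v_{dc}$. The load in the stationary $\alpha\beta$-frame is $\dot s_l=\omega\boldsymbol{J}s_l$, $i_l=(G_l\boldsymbol{I}+B_l\boldsymbol{J})v_{\alpha\beta}+s_l$; since it rotates with the same frequency $\omega$ as the frame, $s_{l,dq}$ (the $dq$-representation of $s_l$) is a constant vector in $\mathbb{R}^2$. *)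

(* Defs.v *)
From HB Require Import structures.
From mathcomp Require Import all_boot all_order all_algebra.
From mathcomp Require Import all_classical all_reals all_analysis.

Set Implicit Arguments.
Unset Strict Implicit.
Unset Printing Implicit Defensive.

Import Order.TTheory GRing.Theory Num.Theory.
Import numFieldNormedType.Exports.

Local Open Scope classical_set_scope.
Local Open Scope ring_scope.

(* The norm `|v| that MathComp-Analysis puts on matrices is the sup norm. *)
Definition euclidean_norm (R : realType) (n : nat) (v : 'cV[R]_n) : R :=
  Num.sqrt (\sum_(i < n) v i 0 ^+ 2).

Section Autonomous.
Variables (R : realType) (V : normedModType R).
Implicit Types (f : V -> V) (x : R -> V).

(* Solutions live on [0, +oo[; the values of x at negative times are junk.
   Since f is continuous in our use, continuity at 0 together with the equation
   for t > 0 amounts to requiring the equation at 0 with a right derivative. *)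
Definition is_solution f x : Prop :=
  {within `[0, +oo[, continuous x} /\
  forall t : R, 0 < t -> is_derive t 1 x (f (x t)).

Definition steady_state f (xs : V) : Prop := f xs = 0.

Definition forward_complete f : Prop :=
  forall x0 : V, exists2 x, is_solution f x & x 0 = x0.

Definition stable f (xs : V) : Prop :=
  forall e : R, 0 < e -> exists2 d : R, 0 < d &
    forall x, is_solution f x -> `|x 0 - xs| < d ->
    forall t : R, 0 <= t -> `|x t - xs| < e.

Definition globally_attractive f (xs : V) : Prop :=
  forall x, is_solution f x -> x t @[t --> +oo] --> xs.

(* Without forward completeness, global attractivity could hold vacuously. *)
Definition globally_asymptotically_stable f (xs : V) : Prop :=
  [/\ forward_complete f, stable f xs & globally_attractive f xs].

End Autonomous.

Section Converter.
Variable R : realType.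

Definition J : 'M[R]_2 := delta_mx 1 0 - delta_mx 0 1.

Definition e2 : 'cV[R]_2 := delta_mx 1 0.

Record params := Params {
  C_dc : R; G_dc : R;
  L_ac : R; R_ac : R;
  C_ac : R; G_ac : R;
  eta : R;
  mu : R;
  G_l : R; B_l : R;
  K_p : R; i_dc_ref : R; v_dc_ref : R
}.

Definition state : normedModType R := (R * 'cV[R]_2 * 'cV[R]_2)%type.

Definition v_dc (x : state) : R := x.1.1.
Definition i_dq (x : state) : 'cV[R]_2 := x.1.2.
Definition v_dq (x : state) : 'cV[R]_2 := x.2.

Variable p : params.

Definition converter (i_dc : R) (i_l : 'cV[R]_2) (x : state) : state :=
  ((C_dc p)^-1 *
     (- G_dc p * v_dc x + i_dc - mu p / 2 * (e2^T *m i_dq x) 0 0),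
   (L_ac p)^-1 *:
     (- R_ac p *: i_dq x - (v_dc x * eta p * L_ac p) *: (J *m i_dq x)
      + (mu p / 2 * v_dc x) *: e2 - v_dq x),
   (C_ac p)^-1 *:
     (- G_ac p *: v_dq x - (v_dc x * eta p * C_ac p) *: (J *m v_dq x)
      - i_l + i_dq x)).

Definition dc_controller (x : state) : R :=
  i_dc_ref p - K_p p * (v_dc x - v_dc_ref p).

Definition ac_load (s_l : 'cV[R]_2) (x : state) : 'cV[R]_2 :=
  (G_l p *: 1%:M + B_l p *: J) *m v_dq x + s_l.

Definition closed_loop (s_l : 'cV[R]_2) (x : state) : state :=
  converter (dc_controller x) (ac_load s_l x) x.

End Converter.

(* Main.v *)
From HB Require Import structures.
Require Import Defs.
From mathcomp Require Import all_boot all_order all_algebra.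
From mathcomp Require Import all_classical all_reals all_analysis.
From mathcomp Require Import ring lra.
Import Order.TTheory GRing.Theory Num.Theory.
Import numFieldNormedType.Exports.
Local Open Scope ring_scope.

(** Write [(a, b, c)] for the deviation of the state from the steady state
    [xs], and let the energy be
    [C_dc a^2 / 2 + L |b|^2 / 2 + C |c|^2 / 2]. The only nonlinear terms of the
    closed loop are the products [v_dc J i_dq] and [v_dc J v_dq]. As [J] is
    skew-symmetric, they do no work except through the values of [i_dq] and
    [v_dq] at [xs]; the exchange of power between the DC side, the inductor and
    the capacitor cancels as well. Along the closed loop the energy thus has
    derivative
      [- (G_dc + K_p) a^2 - R |b|^2 - (G + G_l) |c|^2]
    plus two cross terms, [a] times a linear form in [b] and [a] times a linear
    form in [c], whose coefficients are, up to a quarter turn, [eta L i_dq] and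
    [eta C v_dq] at [xs]. Completing the squares, the assumption on [xs] says
    precisely that this quadratic form is negative definite ([dissipation]), so
    the energy decays exponentially ([energy_decay], [lyapunov_decay]).
    Stability and global attractivity follow, and attractivity forces any other
    steady state, being a constant solution, to equal [xs].

    Global asymptotic stability also asserts that solutions exist for all
    nonnegative times. The vector field is only locally Lipschitz, so it is
    first multiplied by a scalar cutoff: the result is globally Lipschitz, and
    the Picard iteration converges on the whole half-line
    ([picard_lindelof]). The cutoff being nonnegative, the energy is still
    nonincreasing along the modified field; its solution therefore stays in the
    region where the cutoff equals 1 and solves the original equation
    ([lyapunov_forward_complete]).

    The Picard iteration takes place in an arbitrary normed space in which
    Cauchy filters converge and continuous curves have primitives. Both
    properties hold for the reals and pass to matrices and products, hence hold
    for the state space. *)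

Set Implicit Arguments.
Unset Strict Implicit.
Unset Printing Implicit Defensive.
Local Open Scope classical_set_scope.

(** * Complete normed spaces *)

(** A property of the space rather than a structure on it, so that a mere
    lemma transfers it to products. *)
Definition cauchy_complete (R : realType) (V : normedModType R) : Prop :=
  forall F : set_system V, ProperFilter F -> cauchy F -> cvg F.

Lemma cauchy_completeR (R : realType) : cauchy_complete R.
Proof. exact: R_complete. Qed.

Lemma cauchy_complete_mx (R : realType) m n : cauchy_complete 'M[R]_(m, n).
Proof. by move=> F FF cF; exact: mx_complete. Qed.

Lemma cauchy_complete_prod (R : realType) (U V : normedModType R) :
  cauchy_complete U -> cauchy_complete V -> cauchy_complete (U * V)%type.
Proof.
move=> cU cV F FF Fc.
have c1 : cvg (fst @ F).
  apply: (cU (fst @ F) _) => A /= entA; rewrite near_simpl -near2E near_map2.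
  apply: Fc; exists (A, setT); first by split=> //; exact: filterT.
  by move=> [[a c] [b d]] [/= ? ?]; exists ((a, b), (c, d)).
have c2 : cvg (snd @ F).
  apply: (cV (snd @ F) _) => A /= entA; rewrite near_simpl -near2E near_map2.
  apply: Fc; exists (setT, A); first by split=> //; exact: filterT.
  by move=> [[a c] [b d]] [/= ? ?]; exists ((a, b), (c, d)).
move: c1 c2 => /cvg_ex[u uF] /cvg_ex[v vF]; apply/cvg_ex; exists (u, v).
have -> : F = (fun z => (z.1, z.2)) @ F.
  suff -> : (fun z : U * V => (z.1, z.2)) = id by [].
  by apply/funext => -[].
exact: cvg_pair.
Qed.

Lemma is_derive_pair (R : realType) (U V : normedModType R)
    (f : R -> U) (g : R -> V) (t : R) df dg :
  is_derive t 1 f df -> is_derive t 1 g dg ->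
  is_derive t 1 (fun s => (f s, g s)) (df, dg).
Proof.
move=> [f1 f2] [g1 g2].
suff H : h^-1 *: (((fun s => (f s, g s)) \o shift t) (h *: 1) - (f t, g t))
   @[h --> 0^'] --> (df, dg).
  apply: DeriveDef; first by apply/cvg_ex; exists (df, dg).
  by apply: cvg_lim => //.
rewrite -f2 -g2.
exact: cvg_pair f1 g1.
Qed.

Lemma is_derive_mx (R : realType) m n (f : R -> 'M[R]_(m, n)) (t : R)
    (df : 'M[R]_(m, n)) :
  (forall i j, is_derive t 1 (fun s => f s i j) (df i j)) ->
  is_derive t 1 f df.
Proof.
move=> fij.
have dft : derivable f t 1 by apply/derivable_mxP => i j; exact: ex_derive.
apply: DeriveDef => //; rewrite derive_mx//; apply/matrixP => i j.
by rewrite mxE; exact: derive_val.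
Qed.

(** The derivative is two-sided at 0 as well: solutions on the half-line are
    restrictions of curves that are differentiable at 0. *)
Definition has_primitives (R : realType) (V : normedModType R) : Prop :=
  forall g : R -> V, continuous g ->
  exists G : R -> V, forall t : R, 0 <= t -> is_derive t 1 G (g t).

(** Integrating from [-1] puts 0 in the interior of the domain of the
    primitive. *)
Lemma has_primitivesR (R : realType) : has_primitives R.
Proof.
move=> g cg.
exists (fun t => \int[lebesgue_measure]_(s in `[-1, t]) g s)%R => t t0.
have [||||dG G'] := @continuous_FTC1_closed R g (-1) t (t + 1).
- by rewrite ltrDl.
- apply: continuous_compact_integrable; first exact: segment_compact.
  exact: continuous_subspaceT.
- by rewrite (lt_le_trans _ t0)// ltrN10.
- exact: cg.
by apply: DeriveDef => //; rewrite -derive1E.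
Qed.

Lemma has_primitives_prod (R : realType) (U V : normedModType R) :
  has_primitives U -> has_primitives V -> has_primitives (U * V)%type.
Proof.
move=> pU pV g cg.
have [G1 G1g] : exists G : R -> U,
    forall t : R, 0 <= t -> is_derive t 1 G (g t).1.
  by apply: pU => t; apply: continuous_comp; [exact: cg|exact: cvg_fst].
have [G2 G2g] : exists G : R -> V,
    forall t : R, 0 <= t -> is_derive t 1 G (g t).2.
  by apply: pV => t; apply: continuous_comp; [exact: cg|exact: cvg_snd].
exists (fun t => (G1 t, G2 t)) => t t0; rewrite [g t]surjective_pairing.
by apply: is_derive_pair; [exact: G1g|exact: G2g].
Qed.

Lemma has_primitives_mx (R : realType) m n : has_primitives 'M[R]_(m, n).
Proof.
move=> g cg.
have /choice[G Gg] : forall ij : 'I_m * 'I_n, exists G : R -> R,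
    forall t : R, 0 <= t -> is_derive t 1 G (g t ij.1 ij.2).
  move=> ij; apply: has_primitivesR => t.
  apply: (@continuous_comp _ _ _ g (fun M : 'M[R]_(m, n) => M ij.1 ij.2)).
    exact: cg.
  exact: coord_continuous.
exists (fun t => \matrix_(i, j) G (i, j) t) => t t0.
apply: is_derive_mx => i j.
rewrite (_ : (fun s => _) = G (i, j)); first exact: Gg.
by apply/funext => s; rewrite mxE.
Qed.

Lemma increment_bound (R : realType) (V : normedModType R)
    (u : R -> V) (du : V) (c e : R) :
  is_derive c 1 u du -> 0 < e ->
  \forall h \near (0 : R)^'+, `|u (c + h) - u c - h *: du| <= e * h.
Proof.
move=> [cu du_val] e0.
have /cvgrPdist_le/(_ _ e0) : h^-1 *: ((u \o shift c) (h *: 1) - u c)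
    @[h --> (0 : R)^'] --> du by rewrite -du_val.
rewrite !near_withinE /=; apply: filterS => h + h0.
move=> /(_ (lt0r_neq0 h0)); rewrite [h *: 1]mulr1 (addrC h).
rewrite -(ler_pM2r h0) => /(le_trans _); apply.
rewrite [leRHS]mulrC -[X in X * _]gtr0_norm// -normrZ scalerBr.
by rewrite scalerA divff ?gt_eqF// scale1r distrC.
Qed.

(** Primitives are taken of curves that are continuous on the whole line; a
    curve that matters on the half-line only is first made constant before 0. *)
Lemma continuous_max0 (R : realType) (T : topologicalType) (f : R -> T) :
  (forall t : R, 0 <= t -> {for t, continuous f}) ->
  continuous (fun t : R => f (Num.max 0 t)).
Proof.
move=> cf t; apply: (@continuous_comp _ _ _ (fun t : R => Num.max 0 t) f).
  by apply: continuous_max; [exact: cvg_cst|exact: cvg_id].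
by apply: cf; rewrite le_max lexx.
Qed.

Lemma is_derive_continuous (R : realType) (V : normedModType R) (f : R -> V)
  (t : R) df : is_derive t 1 f df -> {for t, continuous f}.
Proof.
by move=> [df1 _]; apply: differentiable_continuous; apply/derivable1_diffP.
Qed.

(** There is no mean value theorem for vector-valued curves. Instead, for each
    [e > 0], consider the last time at which the bound holds with an additional
    slack, [e] times the elapsed time. It cannot precede the given time, because
    the derivatives extend the bound slightly further; then [e] tends to 0. *)
Lemma mean_value_ineq (R : realType) (V : normedModType R)
    (u du : R -> V) (phi dphi : R -> R) :
  (forall t : R, 0 <= t -> is_derive t 1 u (du t)) ->
  (forall t : R, 0 <= t -> is_derive t 1 phi (dphi t)) ->
  (forall t : R, 0 <= t -> `|du t| <= dphi t) ->
  forall t : R, 0 <= t -> `|u t - u 0| <= phi t - phi 0.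
Proof.
move=> u' phi' le_du T T0.
suff H (e : R) : 0 < e -> `|u T - u 0| - (phi T - phi 0) - e * T <= 0.
  apply/ler_addgt0Pr => e e0.
  (* The denominator is [T + 1] rather than [T], which may vanish. *)
  have T1 : 0 < T + 1 by rewrite ltr_wpDl.
  have := H (e / (T + 1)) (divr_gt0 e0 T1).
  suff : e / (T + 1) * T <= e by lra.
  by rewrite -mulrA ler_piMr ?(ltW e0)// mulrC ler_pdivrMr// mul1r lerDl.
move=> e0.
pose h s := `|u s - u 0| - (phi s - phi 0) - e * s.
rewrite -/(h T).
have ch t : 0 <= t -> {for t, continuous h}.
  move=> t0; apply: cvgB; last by apply: cvgM; [exact: cvg_cst|exact: cvg_id].
  apply: cvgB.
    apply: cvg_norm; apply: cvgB; last exact: cvg_cst.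
    exact: is_derive_continuous (u' t t0).
  apply: cvgB; last exact: cvg_cst.
  exact: is_derive_continuous (phi' t t0).
(* Nothing is known of [h] before 0, hence the maximum, which makes [A] closed
   without changing it inside the segment. *)
pose A := `[0, T]%classic `&` [set s | h (Num.max 0 s) <= 0].
have cA : compact A.
  apply: compact_closedI; first exact: segment_compact.
  rewrite (_ : [set s | _] =
    (fun s => h (Num.max 0 s)) @^-1` [set y | y <= 0])//.
  apply: closed_comp => [s _|]; last exact: closed_le.
  exact: continuous_max0.
have [||c] := @compact_EVT_max _ R id A _ cA.
- exists 0; split; first by rewrite /= in_itv/= lexx T0.
  by rewrite /h /= maxxx !subrr normr0 mulr0 !subr0.
- by apply: continuous_subspaceT => s; exact: cvg_id.
rewrite inE => -[] /=; rewrite in_itv/= => /andP[c0 cT].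
rewrite max_r// => hc cmax.
have [cltT|] := ltP c T; last by move=> Tc; rewrite (@le_anti _ _ T c)// cT Tc.
have e20 : 0 < e / 2 by rewrite divr_gt0.
near (0 : R)^'+ => d.
have d0 : 0 < d by near: d; exact: nbhs_right_gt.
have ub : `|u (c + d) - u c - d *: du c| <= e / 2 * d.
  by near: d; exact: increment_bound (u' c c0) e20.
have pb : `|phi (c + d) - phi c - d * dphi c| <= e / 2 * d.
  by near: d; exact: increment_bound (phi' c c0) e20.
have dT : c + d <= T.
  by rewrite -lerBrDl; near: d; apply: nbhs_right_le; rewrite subr_gt0.
have cd0 : 0 <= c + d by rewrite addr_ge0// ltW.
have : id (c + d) <= id c.
  apply: cmax; rewrite inE; split; rewrite /= ?in_itv/= ?cd0 ?dT//.
  rewrite max_r// /h.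
  have tri : `|u (c + d) - u 0| <= `|u c - u 0| + (e / 2 * d + d * dphi c).
    rewrite (_ : u (c + d) - u 0 = (u c - u 0) +
      ((u (c + d) - u c - d *: du c) + d *: du c)); last first.
      by rewrite addrNK [RHS]addrC addrA addrNK.
    apply: (le_trans (ler_normD _ _)); rewrite lerD2l.
    apply: (le_trans (ler_normD _ _)); apply: lerD => //.
    by rewrite normrZ gtr0_norm// ler_pM2l// le_du.
  move: pb; rewrite ler_norml => /andP[pb _].
  move: hc; rewrite /h => hc.
  suff : e * (c + d) = e * c + e / 2 * d + e / 2 * d by lra.
  by field.
by rewrite /= leNgt ltrDl d0.
Unshelve. all: by end_near. Qed.

(** * Global existence for Lipschitz vector fields *)

Lemma geometric_small (R : realType) (c e : R) : 0 < e ->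
  exists n, forall m, (n <= m)%N -> c * 2^-1 ^+ m <= e.
Proof.
move=> e0.
have /cvgrPdist_le/(_ _ e0)[n _ nP] : geometric c 2^-1 @ \oo --> (0 : R).
  by apply: cvg_geometric; rewrite ger0_norm ?invr_ge0// invf_lt1// ltr1n.
exists n => m nm; have := nP m nm; rewrite /geometric/= sub0r normrN.
exact/le_trans/ler_norm.
Qed.

Lemma lipschitz_continuous (R : realType) (V W : normedModType R) (F : V -> W)
    (K : R) : (forall x y, `|F x - F y| <= K * `|x - y|) -> continuous F.
Proof.
move=> lipF x; apply/cvgrPdist_le => e e0.
have K1 : 0 < `|K| + 1 by rewrite ltr_wpDl.
have eK := divr_gt0 e0 K1.
have /cvgrPdist_le/(_ _ eK) near_x : id y @[y --> x] --> x by exact: cvg_id.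
near=> y; apply: (le_trans (lipF x y)).
apply: (@le_trans _ _ ((`|K| + 1) * `|x - y|)).
  by rewrite ler_wpM2r// (le_trans (ler_norm K))// lerDl.
rewrite mulrC -ler_pdivlMr//; near: y.
Unshelve. all: by end_near. Qed.

(** The Picard iterates satisfy
    [|X_(n+1) - X_n| (t) <= D 2^-(n+1) e^(2Kt)]: integrating the Lipschitz bound
    [K e^(2Kt)] gives [e^(2Kt) / 2], which gains a factor 2 at each step. The
    iterates therefore converge at every nonnegative time, with no restriction
    on the length of the interval. *)
Theorem picard_lindelof (R : realType) (V : normedModType R) (F : V -> V)
    (K : R) :
  cauchy_complete V -> has_primitives V -> 0 < K ->
  (forall x y, `|F x - F y| <= K * `|x - y|) ->
  forall x0, exists2 x : R -> V, x 0 = x0 &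
    forall t : R, 0 <= t -> is_derive t 1 x (F (x t)).
Proof.
move=> bV pV K0 lipF x0.
have cF : continuous F := lipschitz_continuous lipF.
pose cont (y : R -> V) := forall t : R, 0 <= t -> {for t, continuous y}.
have /choice[P Pcont] : forall y : R -> V, exists z : R -> V, cont y ->
    z 0 = x0 /\ forall t : R, 0 <= t -> is_derive t 1 z (F (y t)).
  move=> y; have [cy|] := pselect (cont y); last by exists (cst x0).
  have [|G G'] := pV (fun t => F (y (Num.max 0 t))).
    by move=> t; apply: continuous_comp; [exact: continuous_max0|exact: cF].
  exists (fun t => x0 + (G t - G 0)) => _; split; first by rewrite subrr addr0.
  move=> t t0; have := G' t t0; rewrite max_r// => Gt.
  apply: is_derive_eq; by rewrite add0r subr0.
pose X n := iter n P (cst x0).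
have cX n : cont (X n).
  elim: n => [|n IHn] t t0; first exact: cvg_cst.
  exact: is_derive_continuous ((Pcont _ IHn).2 t t0).
have X0 n : X n 0 = x0 by case: n => [//|n]; exact: (Pcont _ (cX n)).1.
have X' n : forall t : R, 0 <= t -> is_derive t 1 (X n.+1) (F (X n t)).
  exact: (Pcont _ (cX n)).2.
(* With this [D], the first increment, whose derivative is [F x0], obeys the
   general bound. *)
pose D : R := `|F x0| / K.
pose B n (t : R) : R := D * 2^-1 ^+ n * expR (2 * K * t).
have B' n (t : R) : is_derive t 1 (B n) (2 * K * B n t).
  have EK : is_derive t 1 (fun s : R => 2 * K * s) (2 * K).
    by apply: is_derive_eq; rewrite [_ *: _]mulr1.
  have := is_derive1_comp (is_derive_expR (2 * K * t)) EK.
  move=> /(is_deriveZ (D * 2^-1 ^+ n)) H; apply: (is_derive_eq H).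
  by rewrite /B [_ *: _]mulrA mulrC mulrA.
have B'S n (t : R) : is_derive t 1 (B n.+1) (K * B n t).
  by apply: (is_derive_eq (B' n.+1 t)); rewrite /B exprS; field.
have B_ge0 n t : 0 <= B n t.
  by rewrite /B !mulr_ge0// ?expR_ge0// ?exprn_ge0// ?invr_ge0// ltW.
have compare n (y z : R -> V) (dy dz : R -> V) : y 0 = z 0 ->
    (forall t : R, 0 <= t -> is_derive t 1 y (dy t)) ->
    (forall t : R, 0 <= t -> is_derive t 1 z (dz t)) ->
    (forall t : R, 0 <= t -> `|dy t - dz t| <= K * B n t) ->
    forall t : R, 0 <= t -> `|y t - z t| <= B n.+1 t.
  move=> yz0 y' z' dyz t t0.
  have yz' (s : R) : 0 <= s -> is_derive s 1 (y - z) (dy s - dz s).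
    by move=> s0; have := y' s s0; have := z' s s0 => ? ?; exact: is_deriveB.
  have := mean_value_ineq yz' (fun s _ => B'S n s) dyz t0.
  rewrite !fctE yz0 subrr subr0 => /le_trans; apply.
  by rewrite gerBl.
have gap n (t : R) : 0 <= t -> `|X n.+1 t - X n t| <= B n.+1 t.
  elim: n t => [|n IHn] t t0.
    apply: (compare 0%N _ _ (fun=> F x0) (fun=> 0)) => // s s0.
    rewrite subr0 /B expr0 mulr1 /D mulrA [K * _]mulrC divfK ?gt_eqF//.
    rewrite ler_peMr// -expR0 ler_expR.
    by rewrite !mulr_ge0// ltW.
  apply: (compare n.+1 _ _ (fun s => F (X n.+1 s)) (fun s => F (X n s))) => //.
  - by rewrite !X0.
  - move=> s s0; apply: (le_trans (lipF _ _)).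
    by rewrite ler_pM2l//; exact: IHn.
have tail n m (t : R) : 0 <= t ->
    `|X (n + m)%N t - X n t| <= B n t - B (n + m)%N t.
  move=> t0; elim: m => [|m IHm]; first by rewrite addn0 !subrr normr0.
  rewrite addnS; have := gap (n + m)%N t t0.
  have := ler_distD (X (n + m)%N t) (X (n + m).+1 t) (X n t).
  suff : B (n + m)%N t = 2 * B (n + m).+1 t by lra.
  by rewrite /B exprS; field.
have B_small (t e : R) : 0 < e -> exists n, B n t <= e.
  move=> /(geometric_small (D * expR (2 * K * t)))[n /(_ n (leqnn n)) nP].
  by exists n; rewrite /B mulrAC.
have B_decr n m t : (n <= m)%N -> B m t <= B n t.
  move=> nm; rewrite /B ler_wpM2r ?expR_ge0// ler_wpM2l ?divr_ge0 ?(ltW K0)//.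
  by apply: ler_wiXn2l => //; rewrite ?invr_ge0// invf_le1// ler1n.
have cvgX (t : R) : 0 <= t -> cvg (X n t @[n --> \oo]).
  move=> t0; apply: (bV (X n t @[n --> \oo]) _); apply: cauchy_exP => e e0.
  have e20 : 0 < e / 2 by rewrite divr_gt0.
  have [n Bn] := B_small t _ e20; exists (X n t), n => // m /= nm.
  rewrite -ball_normE /= distrC -(subnKC nm).
  apply: (le_lt_trans (tail n (m - n)%N t t0)).
  have := B_ge0 (n + (m - n))%N t; lra.
pose x (t : R) := lim (X n (Num.max 0 t) @[n --> \oo]).
have xX n (t : R) : 0 <= t -> `|x t - X n t| <= B n t.
  move=> t0; rewrite /x max_r//; apply/ler_addgt0Pr => e e0.
  have /cvgrPdist_le/(_ _ e0)[m _ mP] := cvgX t t0.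
  have := mP (n + m)%N (leq_addl _ _).
  have := ler_distD (X (n + m)%N t) (lim (X n t @[n --> \oo])) (X n t).
  have := tail n m t t0; have := B_ge0 (n + m)%N t; rewrite /=; lra.
have x_max (t : R) : x (Num.max 0 t) = x t by rewrite /x maxA maxxx.
have cx : cont x.
  move=> t t0; apply/cvgrPdist_le => e e0.
  have e30 : 0 < e / 3 by rewrite divr_gt0.
  have [n Bn] := B_small (t + 1) _ e30.
  have cXn := continuous_max0 (cX n).
  have /cvgrPdist_le/(_ _ e30) Xnear := cXn t.
  near=> s.
  have s0 : 0 <= Num.max 0 s by rewrite le_max lexx.
  have st : Num.max 0 s <= t + 1.
    rewrite ge_max addr_ge0//=.
    by apply: ltW; near: s; apply: lt_nbhsl; rewrite ltrDl.
  have BtS r : r <= t + 1 -> B n r <= e / 3.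
    move=> rt; apply: le_trans Bn; rewrite /B.
    apply: ler_wpM2l; last by rewrite ler_expR ler_pM2l// mulr_gt0.
    by rewrite mulr_ge0 ?exprn_ge0 ?divr_ge0 ?(ltW K0).
  rewrite -(x_max s).
  have := xX n t t0; have := xX n _ s0; rewrite (distrC (x (Num.max 0 s))).
  have := BtS _ st; have /BtS : t <= t + 1 by rewrite lerDl.
  have : `|X n (Num.max 0 t) - X n (Num.max 0 s)| <= e / 3 by near: s.
  rewrite [in Num.max 0 t]max_r//.
  have := ler_distD (X n t) (x t) (x (Num.max 0 s)).
  have := ler_distD (X n (Num.max 0 s)) (X n t) (x (Num.max 0 s)).
  lra.
(* The limit need not be differentiable at 0 from the left, so the solution is
   its image by the Picard operator, which agrees with it after 0. *)
have [Y0 Y'] := Pcont x cx.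
exists (P x) => // t t0.
rewrite (_ : P x t = x t); first exact: Y'.
apply/eqP; rewrite -subr_eq0 -normr_le0; apply/ler_addgt0Pr => e e0.
have e20 : 0 < e / 2 by rewrite divr_gt0.
have [n Bn] := B_small t _ e20.
have : `|P x t - X n.+1 t| <= B n.+1 t.
  apply: (compare n _ _ (fun s => F (x s)) (fun s => F (X n s))) => //.
  - by rewrite X0.
  - move=> s s0; apply: (le_trans (lipF _ _)).
    by rewrite ler_pM2l//; exact: xX.
have := xX n.+1 t t0; have := B_decr n n.+1 t (leqnSn n).
have := ler_distD (X n.+1 t) (P x t) (x t).
rewrite (distrC (x t)); lra.
Unshelve. all: by end_near. Qed.

(** * Cutoff of a locally Lipschitz vector field *)

(** The form of local Lipschitz continuity that a cutoff makes global. *)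
Definition lipschitz_on_balls (R : realType) (V W : normedModType R)
    (f : V -> W) : Prop :=
  forall M : R, exists2 K : R, 0 <= K &
    forall x y : V, `|x| <= M -> `|y| <= M -> `|f x - f y| <= K * `|x - y|.

Lemma lipschitz_on_balls_bounded (R : realType) (V W : normedModType R)
    (f : V -> W) (M : R) : lipschitz_on_balls f ->
  exists2 B : R, 0 <= B & forall x, `|x| <= M -> `|f x| <= B.
Proof.
move=> /(_ M)[K K0 fK].
exists (`|f 0| + K * `|M|) => [|x xM]; first by rewrite addr_ge0// mulr_ge0.
have M0 : 0 <= M := le_trans (normr_ge0 x) xM.
rewrite -(subrK (f 0) (f x)) addrC (le_trans (ler_normD _ _))// lerD2l.
apply: (le_trans (fK _ _ xM _)); first by rewrite normr0.
by rewrite subr0 ler_wpM2l// (le_trans xM)// ler_norm.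
Qed.

Section Cutoff.
Variables (R : realType) (V : normedModType R) (f : V -> V) (M : R).
Hypothesis f_lip : lipschitz_on_balls f.

Definition cutoff (x : V) : R := Num.max 0 (Num.min 1 (M + 1 - `|x|)).

Lemma cutoff_ge0 x : 0 <= cutoff x.
Proof. by rewrite le_max lexx. Qed.

Lemma cutoff_le1 x : cutoff x <= 1.
Proof. by rewrite ge_max ler01 ge_min lexx. Qed.

Lemma cutoff_inside x : `|x| <= M -> cutoff x = 1.
Proof.
by move=> xM; rewrite /cutoff min_l ?max_r// -addrA addrCA lerDl subr_ge0.
Qed.

Lemma cutoff_outside x : M + 1 <= `|x| -> cutoff x = 0.
Proof. by move=> xM; rewrite /cutoff max_l// ge_min subr_le0 xM orbT. Qed.

Lemma cutoff_lipschitz x y : `|cutoff x - cutoff y| <= `|x - y|.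
Proof.
apply: le_trans (ler_dist_dist x y).
rewrite /cutoff; move: `|x| `|y| => a b.
have clampE (p : R) : let c := Num.max 0 (Num.min 1 p) in
    [\/ [/\ 1 <= p, 0 <= p & c = 1], [/\ 0 <= p, p <= 1 & c = p]
      | [/\ p <= 0, p <= 1 & c = 0]].
  have [p1|p1] /= := leP 1 p.
    by rewrite max_r//; apply: Or31; split=> //; exact: le_trans p1.
  have [p0|p0] := leP 0 p; first by apply: Or32; rewrite ltW.
  by apply: Or33; rewrite !ltW.
have := ler_norm (a - b); have := ler_norm (b - a); rewrite distrC ler_norml.
by have [] := clampE (M + 1 - a) => -[? ? ->];
  have [] := clampE (M + 1 - b) => -[? ? ->]; lra.
Qed.

(** Two points of the ball of radius [M + 1] are handled by the product rule.
    A point outside that ball contributes 0, so only the variation of the cutoff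
    matters there. *)
Lemma cutoff_scale_lipschitz : exists2 K : R, 0 < K &
  forall x y, `|cutoff x *: f x - cutoff y *: f y| <= K * `|x - y|.
Proof.
have [K K0 fK] := f_lip (M + 1).
have [B B0 fB] := lipschitz_on_balls_bounded (M + 1) f_lip.
have KB1 : 0 < K + B + 1 by rewrite ltr_wpDl// addr_ge0.
exists (K + B + 1) => // x y.
wlog yM : x y / `|y| <= M + 1.
  move=> H; have [/H//|yM] := lerP `|y| (M + 1).
  have [xM|xM] := lerP `|x| (M + 1).
    by rewrite distrC (distrC x); exact: H.
  rewrite !cutoff_outside ?(ltW yM) ?(ltW xM)// !scale0r subrr normr0.
  by rewrite mulr_ge0// ltW.
rewrite (_ : _ - _ = cutoff x *: (f x - f y) + (cutoff x - cutoff y) *: f y);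
  last by rewrite scalerBr scalerBl addrA subrK.
apply: (le_trans (ler_normD _ _)); rewrite -addrA mulrDl; apply: lerD.
  rewrite normrZ (ger0_norm (cutoff_ge0 x)).
  have [xM|xM] := lerP `|x| (M + 1); last first.
    by rewrite cutoff_outside ?(ltW xM)// mul0r mulr_ge0.
  apply: le_trans (fK x y xM yM).
  by rewrite ler_piMl// cutoff_le1.
rewrite normrZ mulrC mulrDl ler_wpDr ?mul1r//.
apply: ler_pM => //; [exact: fB|exact: cutoff_lipschitz].
Qed.

End Cutoff.

(** * Lyapunov functions *)

Section Lyapunov.
Variables (R : realType) (V : normedModType R).

Lemma is_derive_along (W : V -> R) (x : R -> V) (t : R) v :
  differentiable W (x t) -> is_derive t 1 x v ->
  is_derive t 1 (W \o x) ('d W (x t) v).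
Proof.
move=> dW [x1 xv].
have dx : differentiable x t by apply/derivable1_diffP.
have dWx : differentiable (W \o x) t by exact: differentiable_comp.
apply: DeriveDef; first exact: diff_derivable.
by rewrite deriveE// diff_comp//= -xv deriveE.
Qed.

(** The function [expR (k t) * W (x t)] is nonincreasing. The case [k = 0] is
    also of use: it says that sublevel sets of [W] are positively invariant. *)
Lemma lyapunov_decay (f : V -> V) (W : V -> R) (k : R) (x : R -> V) :
  (forall z, differentiable W z) ->
  (forall z, 'd W z (f z) <= - k * W z) ->
  is_solution f x ->
  forall t : R, 0 <= t -> W (x t) <= expR (- k * t) * W (x 0).
Proof.
move=> dW Wf [cx x'] t t0.
pose h s := expR (k * s) * W (x s).
have h' (s : R) : 0 < s ->
    is_derive s 1 h (expR (k * s) * (k * W (x s) + 'd W (x s) (f (x s)))).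
  move=> s0.
  have ks : is_derive s 1 (fun s : R => k * s) k.
    by apply: is_derive_eq; rewrite [_ *: _]mulr1.
  have E' := is_derive1_comp (is_derive_expR (k * s)) ks.
  have Wx' := is_derive_along (dW (x s)) (x' s s0).
  apply: (is_derive_eq (is_deriveM E' Wx')).
  have ringE (a b c : R) : b * a + c * (b * k) = b * (k * c + a) by ring.
  exact: ringE.
have : h t <= h 0.
  apply: (@ler0_derive1_nincry _ h 0) => // [s|s|].
  - by rewrite in_itv/= andbT => /h' [].
  - rewrite in_itv/= andbT => /h' s'; rewrite derive1E derive_val.
    rewrite pmulr_rle0 ?expR_gt0//.
    have := Wf (x s); lra.
  - have cE : {within `[0, +oo[, continuous (fun s : R => expR (k * s))}.
      apply: continuous_subspaceT => s.
      apply: (@continuous_comp _ _ _ ( *%R k) expR).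
        exact: mulrl_continuous.
      exact: continuous_expR.
    have cWx : {within `[0, +oo[, continuous (W \o x)}.
      apply/subspace_continuousP => s s0.
      move/subspace_continuousP/(_ s s0) : cx => xs.
      exact: cvg_comp xs (differentiable_continuous (dW (x s))).
    by move=> s; apply: cvgM; [exact: cE|exact: cWx].
rewrite /h mulr0 expR0 mul1r => ht.
by rewrite mulNr expRN mulrC ler_pdivlMr ?expR_gt0// mulrC.
Qed.

(** Differentiability at 0 gives the continuity at 0 that solutions are
    required to have. *)
Lemma is_solution_right (f : V -> V) (x : R -> V) :
  (forall t : R, 0 <= t -> is_derive t 1 x (f (x t))) -> is_solution f x.
Proof.
move=> x'; split; last by move=> t t0; exact: x' (ltW t0).
apply: derivable_within_continuous => t; rewrite in_itv/= andbT => t0.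
by have [] := x' t t0.
Qed.

(** Multiplying the field by a nonnegative scalar preserves the sign of the
    derivative of [W] along it. Solutions of the truncated field hence remain in
    the sublevel set of their initial value, where nothing was truncated. *)
Theorem lyapunov_forward_complete (f : V -> V) (W : V -> R) :
  cauchy_complete V -> has_primitives V -> lipschitz_on_balls f ->
  (forall z, differentiable W z) ->
  (forall z, 'd W z (f z) <= 0) ->
  (forall c : R, exists M : R, forall z, W z <= c -> `|z| <= M) ->
  forward_complete f.
Proof.
move=> bV pV f_lip dW Wf Wproper x0.
have [M WM] := Wproper (W x0).
have [K K0 fK] := cutoff_scale_lipschitz M f_lip.
have [x x00 x'] := picard_lindelof bV pV K0 fK x0.
exists x => //; apply: is_solution_right => t t0.
have sol : is_solution (fun z => cutoff M z *: f z) x.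
  exact: is_solution_right.
have := x' t t0; rewrite cutoff_inside ?scale1r//; apply: WM.
have decr z : 'd W z (cutoff M z *: f z) <= - 0 * W z.
  have -> : 'd W z (cutoff M z *: f z) = cutoff M z *: 'd W z (f z).
    exact: linearZ.
  by rewrite oppr0 mul0r mulr_ge0_le0// cutoff_ge0.
have := lyapunov_decay dW decr sol t0.
by rewrite oppr0 mul0r expR0 mul1r x00.
Qed.

(** Forward completeness needs [W] to have bounded sublevel sets, which the
    quadratic lower bound supplies; stability needs only the continuity of [W]
    at [xs], and attractivity the exponential decay. *)
Theorem lyapunov_globally_asymptotically_stable (f : V -> V) (W : V -> R)
    (xs : V) (k a : R) :
  cauchy_complete V -> has_primitives V -> lipschitz_on_balls f ->
  (forall z, differentiable W z) ->
  0 < a -> (forall z, a * `|z - xs| ^+ 2 <= W z) -> W xs = 0 ->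
  0 < k -> (forall z, 'd W z (f z) <= - k * W z) ->
  globally_asymptotically_stable f xs.
Proof.
move=> bV pV f_lip dW a0 Wa Wxs k0 Wf.
have W0 z : 0 <= W z.
  by apply: le_trans (Wa z); rewrite mulr_ge0 ?(ltW a0)// sqr_ge0.
split.
- apply: (lyapunov_forward_complete (W := W)) => // [z|c].
    by apply: le_trans (Wf z) _; rewrite mulNr oppr_le0 mulr_ge0 ?(ltW k0).
  exists (Num.sqrt (c / a) + `|xs|) => z Wc.
  rewrite -(subrK xs z) (le_trans (ler_normD _ _))// lerD2r.
  rewrite -[leLHS]normr_id -sqrtr_sqr ler_wsqrtr// ler_pdivlMr// mulrC.
  exact: le_trans Wc.
- move=> e e0.
  have ae : 0 < a * e ^+ 2 by rewrite mulr_gt0// exprn_gt0.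
  have /cvgrPdist_lt/(_ _ ae) := differentiable_continuous (dW xs).
  rewrite Wxs => /nbhs_normP[d /= d0 dP]; exists d => // x xsol x0 t t0.
  have Wx0 : W (x 0) < a * e ^+ 2.
    have := dP (x 0); rewrite /= distrC sub0r normrN => /(_ x0).
    exact/le_lt_trans/ler_norm.
  have Wxt : W (x t) <= W (x 0).
    apply: le_trans (lyapunov_decay dW Wf xsol t0) _.
    by rewrite ler_piMl// -expR0 ler_expR mulNr oppr_le0 mulr_ge0// ltW.
  rewrite -(ltr_pXn2r (_ : 0 < 2)%N) ?nnegrE ?(ltW e0)// -(ltr_pM2l a0).
  exact: le_lt_trans (le_trans (Wa _) Wxt) Wx0.
- move=> x xsol; apply/cvgrPdist_lt => e e0.
  have ae : 0 < a * e ^+ 2 by rewrite mulr_gt0// exprn_gt0.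
  near=> t.
  have t0 : 0 <= t by near: t; exact: nbhs_pinfty_ge.
  have tW : W (x 0) / (a * e ^+ 2) / k < t.
    by near: t; apply: nbhs_pinfty_gt; rewrite num_real.
  have Wxt := lyapunov_decay dW Wf xsol t0.
  rewrite distrC -(ltr_pXn2r (_ : 0 < 2)%N) ?nnegrE ?(ltW e0)//.
  rewrite -(ltr_pM2l a0); apply: le_lt_trans (Wa _) _.
  apply: le_lt_trans Wxt _.
  rewrite mulNr expRN mulrC ltr_pdivrMr ?expR_gt0//.
  rewrite mulrC -ltr_pdivrMr//.
  apply: lt_le_trans (expR_ge1Dx (k * t)).
  rewrite ltr_pdivrMr// in tW; rewrite [k * t]mulrC.
  by rewrite (lt_trans tW)// ltrDr.
Unshelve. all: by end_near. Qed.

(** Another steady state would be a constant solution converging to [xs]. *)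
Lemma globally_attractive_unique (f : V -> V) (xs z : V) :
  globally_attractive f xs -> steady_state f z -> z = xs.
Proof.
move=> attr fz.
have sol : is_solution f (cst z).
  by apply: is_solution_right => t _; rewrite /cst fz; exact: is_derive_cst.
have zxs : z @[_ --> (+oo%R : set_system R)] --> xs := attr _ sol.
by rewrite -(cvg_lim _ zxs)// lim_cst.
Qed.

End Lyapunov.

(** * Calculus of Lipschitz and differentiable maps *)

Section LipschitzOnBalls.
Variables (R : realType) (V : normedModType R).

Lemma lipschitz_on_balls_cst (W : normedModType R) (c : W) :
  lipschitz_on_balls (fun _ : V => c).
Proof. by move=> M; exists 0 => // x y _ _; rewrite subrr normr0 mul0r. Qed.

Lemma lipschitz_on_ballsD (W : normedModType R) (f g : V -> W) :
  lipschitz_on_balls f -> lipschitz_on_balls g ->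
  lipschitz_on_balls (fun x => f x + g x).
Proof.
move=> fl gl M; have [K K0 fK] := fl M; have [L L0 gL] := gl M.
exists (K + L) => [|x y xM yM]; first exact: addr_ge0.
rewrite opprD addrACA mulrDl (le_trans (ler_normD _ _))//.
by rewrite lerD ?fK ?gL.
Qed.

Lemma lipschitz_on_ballsM (f g : V -> R) :
  lipschitz_on_balls f -> lipschitz_on_balls g ->
  lipschitz_on_balls (fun x => f x * g x).
Proof.
move=> fl gl M; have [K K0 fK] := fl M; have [L L0 gL] := gl M.
have [A A0 fA] := lipschitz_on_balls_bounded M fl.
have [B B0 gB] := lipschitz_on_balls_bounded M gl.
exists (A * L + K * B) => [|x y xM yM]; first by rewrite addr_ge0// mulr_ge0.
rewrite (_ : _ - _ = f x * (g x - g y) + (f x - f y) * g y); last by ring.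
rewrite (le_trans (ler_normD _ _))// !normrM mulrDl lerD//.
  by rewrite -mulrA ler_pM// ?fA ?gL.
by rewrite mulrAC ler_pM// ?fK ?gB.
Qed.

Lemma lipschitz_on_ballsN (f : V -> R) :
  lipschitz_on_balls f -> lipschitz_on_balls (fun x => - f x).
Proof.
move=> fl; rewrite (_ : (fun _ => _) = (fun x => (-1) * f x)).
  by apply: lipschitz_on_ballsM => //; exact: lipschitz_on_balls_cst.
by apply/funext => x; rewrite mulN1r.
Qed.

Lemma lipschitz_on_balls_pair (U W : normedModType R)
    (f : V -> U) (g : V -> W) :
  lipschitz_on_balls f -> lipschitz_on_balls g ->
  lipschitz_on_balls (fun x => (f x, g x)).
Proof.
move=> fl gl M; have [K K0 fK] := fl M; have [L L0 gL] := gl M.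
exists (K + L) => [|x y xM yM]; first exact: addr_ge0.
rewrite prod_normE /= ge_max; apply/andP; split.
  by rewrite (le_trans (fK _ _ xM yM))// ler_wpM2r// lerDl.
by rewrite (le_trans (gL _ _ xM yM))// ler_wpM2r// lerDr.
Qed.

Lemma mx_norm_le m n (A : 'M[R]_(m, n)) (B : R) :
  0 <= B -> (forall i j, `|A i j| <= B) -> `|A| <= B.
Proof.
move=> B0 AB; rewrite [leLHS]/Num.Def.normr/= mx_normrE.
by apply: bigmax_le => // ij _; exact: AB.
Qed.

Lemma entry_le_norm m n (A : 'M[R]_(m, n)) i j : `|A i j| <= `|A|.
Proof.
by rewrite [leRHS]/Num.Def.normr/= mx_normrE; exact: (le_bigmax _ _ (i, j)).
Qed.

Lemma lipschitz_on_balls_mx m n (f : V -> 'M[R]_(m, n)) :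
  (forall i j, lipschitz_on_balls (fun x => f x i j)) -> lipschitz_on_balls f.
Proof.
move=> fl M.
have /choice[K KP] : forall ij : 'I_m * 'I_n, exists K : R, 0 <= K /\
    forall x y : V, `|x| <= M -> `|y| <= M ->
      `|f x ij.1 ij.2 - f y ij.1 ij.2| <= K * `|x - y|.
  by move=> ij; have [K K0 fK] := fl ij.1 ij.2 M; exists K.
have K0 : 0 <= \sum_ij K ij by apply: sumr_ge0 => ij _; exact: (KP ij).1.
exists (\sum_ij K ij) => // x y xM yM; apply: mx_norm_le => [|i j].
  by rewrite mulr_ge0.
rewrite !mxE (le_trans ((KP (i, j)).2 x y xM yM))// ler_wpM2r//.
rewrite (bigD1 (i, j))//= lerDl; apply: sumr_ge0 => ij _; exact: (KP ij).1.
Qed.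

End LipschitzOnBalls.

Lemma is_diff_continuous_linear (R : realType) (V W : normedModType R)
    (f : V -> W) (x : V) : linear f -> continuous f -> is_diff x f f.
Proof.
move=> f_lin f_cont.
pose fM := GRing.isLinear.Build _ _ _ _ _ f_lin.
pose fL : {linear _ -> _} := HB.pack f fM.
apply: DiffDef; first exact: (@linear_differentiable _ _ _ fL).
exact: (@diff_lin _ _ _ fL).
Qed.

Lemma is_diff_weighted_square (R : realType) (V : normedModType R)
    (l : V -> R) (w c : R) (x : V) : is_diff x l l ->
  is_diff x (fun y => w * (l y - c) ^+ 2) (fun v => w * (2 * (l x - c) * l v)).
Proof.
move=> lx.
have lc : is_diff x (l - cst c) l.
  by apply: is_diff_eq; rewrite subr0.
have := is_diffZ w (is_diffX 1 lc).
by rewrite expr1.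
Qed.

(** * The closed loop in coordinates *)

Section Coordinates.
Variable R : realType.

Definition coord_vdc (x : state R) : R := v_dc x.
Definition coord_idq (j : 'I_2) (x : state R) : R := i_dq x j 0.
Definition coord_vdq (j : 'I_2) (x : state R) : R := v_dq x j 0.

(** The norm of the state space is the sup norm of its five coordinates. *)
Lemma state_norm_le (y : state R) (B : R) : 0 <= B ->
  `|coord_vdc y| <= B ->
  (forall j, `|coord_idq j y| <= B) ->
  (forall j, `|coord_vdq j y| <= B) -> `|y| <= B.
Proof.
move=> B0 yv yi yw; rewrite !prod_normE !ge_max -andbA; apply/and3P.
split=> //; apply: mx_norm_le => // i j; rewrite (ord1 j).
  exact: yi.
exact: yw.
Qed.

Lemma is_diff_coord_vdc (x : state R) : is_diff x coord_vdc coord_vdc.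
Proof.
apply: is_diff_continuous_linear => [a u v|z]; first by [].
exact: (@continuous_comp _ _ _ fst fst _ cvg_fst cvg_fst).
Qed.

Lemma is_diff_coord_idq j (x : state R) : is_diff x (coord_idq j) (coord_idq j).
Proof.
apply: is_diff_continuous_linear => [a u v|z].
  by rewrite /coord_idq /i_dq /= !mxE.
apply: (@continuous_comp _ _ _ (@i_dq R) (fun A : 'cV[R]_2 => A j 0)).
  exact: (@continuous_comp _ _ _ fst snd z cvg_fst cvg_snd).
exact: coord_continuous.
Qed.

Lemma is_diff_coord_vdq j (x : state R) : is_diff x (coord_vdq j) (coord_vdq j).
Proof.
apply: is_diff_continuous_linear => [a u v|z].
  by rewrite /coord_vdq /v_dq /= !mxE.
apply: (@continuous_comp _ _ _ (@v_dq R) (fun A : 'cV[R]_2 => A j 0)).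
  exact: cvg_snd.
exact: coord_continuous.
Qed.

Lemma lipschitz_on_balls_coord (l : state R -> R) :
  (forall x y, l x - l y = l (x - y)) -> (forall x, `|l x| <= `|x|) ->
  lipschitz_on_balls l.
Proof.
by move=> lB l_le M; exists 1 => // x y _ _; rewrite lB mul1r.
Qed.

Lemma lipschitz_on_balls_coord_vdc : lipschitz_on_balls coord_vdc.
Proof.
apply: lipschitz_on_balls_coord => [//|x].
by rewrite !prod_normE !le_max lexx.
Qed.

Lemma lipschitz_on_balls_coord_idq j : lipschitz_on_balls (coord_idq j).
Proof.
apply: lipschitz_on_balls_coord => [x y|x].
  by rewrite /coord_idq /i_dq /= !mxE.
rewrite !prod_normE !le_max; apply/orP; left; apply/orP; right.
exact: entry_le_norm.
Qed.

Lemma lipschitz_on_balls_coord_vdq j : lipschitz_on_balls (coord_vdq j).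
Proof.
apply: lipschitz_on_balls_coord => [x y|x].
  by rewrite /coord_vdq /v_dq /= !mxE.
rewrite !prod_normE !le_max; apply/orP; right.
exact: entry_le_norm.
Qed.

Lemma J_mulmx0 (u : 'cV[R]_2) : (J R *m u) 0 0 = - u 1 0.
Proof.
rewrite mxE !big_ord_recl big_ord0 !mxE /= addr0 subr0 mul0r add0r.
rewrite sub0r mulN1r; congr (- u _ _); exact/val_inj.
Qed.

Lemma J_mulmx1 (u : 'cV[R]_2) : (J R *m u) 1 0 = u 0 0.
Proof.
rewrite mxE !big_ord_recl big_ord0 !mxE /= addr0 subr0 mul1r subrr.
by rewrite mul0r addr0.
Qed.

Lemma load_mulmx (a b : R) (u : 'cV[R]_2) :
  (a *: 1%:M + b *: J R) *m u = a *: u + b *: (J R *m u).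
Proof. by rewrite mulmxDl -!scalemxAl mul1mx. Qed.

Variables (p : params R) (s : 'cV[R]_2).

(** Net current into the DC capacitor, that is [C_dc] times the derivative of
    [v_dc]; likewise, the four quantities below are [L] times the derivative of
    [i_dq] and [C] times that of [v_dq], entry by entry. *)
Definition dc_current (x : state R) : R :=
  - G_dc p * coord_vdc x + (i_dc_ref p - K_p p * (coord_vdc x - v_dc_ref p))
  - mu p / 2 * coord_idq 1 x.

Definition inductor_voltage0 (x : state R) : R :=
  - R_ac p * coord_idq 0 x + coord_vdc x * eta p * L_ac p * coord_idq 1 x
  - coord_vdq 0 x.
Definition inductor_voltage1 (x : state R) : R :=
  - R_ac p * coord_idq 1 x - coord_vdc x * eta p * L_ac p * coord_idq 0 x
  + mu p / 2 * coord_vdc x - coord_vdq 1 x.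

Definition capacitor_current0 (x : state R) : R :=
  - G_ac p * coord_vdq 0 x + coord_vdc x * eta p * C_ac p * coord_vdq 1 x
  - (G_l p * coord_vdq 0 x - B_l p * coord_vdq 1 x + s 0 0) + coord_idq 0 x.
Definition capacitor_current1 (x : state R) : R :=
  - G_ac p * coord_vdq 1 x - coord_vdc x * eta p * C_ac p * coord_vdq 0 x
  - (G_l p * coord_vdq 1 x + B_l p * coord_vdq 0 x + s 1 0) + coord_idq 1 x.

Lemma ord2P (P : 'I_2 -> Prop) : P 0 -> P 1 -> forall j, P j.
Proof.
move=> P0 P1 [[|[|//]] j2].
  by rewrite (_ : Ordinal j2 = 0)//; exact: val_inj.
by rewrite (_ : Ordinal j2 = 1)//; exact: val_inj.
Qed.

Lemma closed_loop_vdc x :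
  coord_vdc (closed_loop p s x) = (C_dc p)^-1 * dc_current x.
Proof.
rewrite /coord_vdc /dc_current /closed_loop /converter /dc_controller /=.
congr (_ * (_ - _ * _)).
rewrite mxE !big_ord_recl big_ord0 !mxE /= addr0 mul0r add0r mul1r.
by congr (x.1.2 _ _); exact: val_inj.
Qed.

Lemma closed_loop_idq0 x :
  coord_idq 0 (closed_loop p s x) = (L_ac p)^-1 * inductor_voltage0 x.
Proof.
rewrite /coord_idq /inductor_voltage0 /closed_loop /converter /i_dq /=.
rewrite !(J_mulmx0, mxE) /=.
by congr (_ * _); rewrite /coord_idq /coord_vdq; ring.
Qed.

Lemma closed_loop_idq1 x :
  coord_idq 1 (closed_loop p s x) = (L_ac p)^-1 * inductor_voltage1 x.
Proof.
rewrite /coord_idq /inductor_voltage1 /closed_loop /converter /i_dq /=.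
rewrite !(J_mulmx1, mxE) /=.
by congr (_ * _); rewrite /coord_idq /coord_vdq; ring.
Qed.

Lemma closed_loop_vdq0 x :
  coord_vdq 0 (closed_loop p s x) = (C_ac p)^-1 * capacitor_current0 x.
Proof.
rewrite /coord_vdq /capacitor_current0 /closed_loop /converter /ac_load.
rewrite /v_dq /=.
rewrite load_mulmx !(J_mulmx0, mxE) /=.
by congr (_ * _); rewrite /coord_idq /coord_vdq; ring.
Qed.

Lemma closed_loop_vdq1 x :
  coord_vdq 1 (closed_loop p s x) = (C_ac p)^-1 * capacitor_current1 x.
Proof.
rewrite /coord_vdq /capacitor_current1 /closed_loop /converter /ac_load.
rewrite /v_dq /=.
rewrite load_mulmx !(J_mulmx1, mxE) /=.
by congr (_ * _); rewrite /coord_idq /coord_vdq; ring.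
Qed.

Lemma eq_lipschitz_on_balls (V W : normedModType R) (f g : V -> W) :
  f =1 g -> lipschitz_on_balls g -> lipschitz_on_balls f.
Proof. by move=> /funext ->. Qed.

(** All five coordinates of the field are polynomials in the state. *)
Lemma lipschitz_on_balls_closed_loop : lipschitz_on_balls (closed_loop p s).
Proof.
Ltac lipschitz_polynomial := repeat first [exact: lipschitz_on_balls_cst
  | exact: lipschitz_on_balls_coord_vdc | exact: lipschitz_on_balls_coord_idq
  | exact: lipschitz_on_balls_coord_vdq | apply: lipschitz_on_ballsD
  | apply: lipschitz_on_ballsN | apply: lipschitz_on_ballsM].
pose f := closed_loop p s.
apply: (@eq_lipschitz_on_balls _ _ _
  (fun x => (((f x).1.1, (f x).1.2), (f x).2))).
  by move=> x; rewrite -!surjective_pairing.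
apply: lipschitz_on_balls_pair; first apply: lipschitz_on_balls_pair.
- apply: (eq_lipschitz_on_balls closed_loop_vdc).
  by rewrite /dc_current; lipschitz_polynomial.
- apply: lipschitz_on_balls_mx => i j; rewrite (ord1 j).
  move: i; apply: ord2P.
    apply: (eq_lipschitz_on_balls closed_loop_idq0).
    by rewrite /inductor_voltage0; lipschitz_polynomial.
  apply: (eq_lipschitz_on_balls closed_loop_idq1).
  by rewrite /inductor_voltage1; lipschitz_polynomial.
- apply: lipschitz_on_balls_mx => i j; rewrite (ord1 j).
  move: i; apply: ord2P.
    apply: (eq_lipschitz_on_balls closed_loop_vdq0).
    by rewrite /capacitor_current0; lipschitz_polynomial.
  apply: (eq_lipschitz_on_balls closed_loop_vdq1).
  by rewrite /capacitor_current1; lipschitz_polynomial.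
Qed.

End Coordinates.

(** * Decay of the energy *)

(** The right-hand side minus the left-hand side is a sum of two squares: this
    is the completion of squares in [b]. The parameter [t] is the share of the
    dissipation spent on absorbing the cross term. *)
Lemma coupling_bound (R : realFieldType) (t r l a b0 b1 i0 i1 : R) :
  0 < t -> 0 < r ->
  - (t * r * (b0 ^+ 2 + b1 ^+ 2)) + a * l * (b0 * i1 - b1 * i0)
  <= a ^+ 2 * (l ^+ 2 * (i0 ^+ 2 + i1 ^+ 2) / (4 * r)) / t.
Proof.
move=> t0 r0; rewrite -subr_ge0.
rewrite (_ : _ - _ = t * r * ((b0 - a * l * i1 / (2 * t * r)) ^+ 2
   + (b1 + a * l * i0 / (2 * t * r)) ^+ 2)); last first.
  by field; rewrite ?gt_eqF//.
by apply: mulr_ge0; [exact: ltW (mulr_gt0 t0 r0)|rewrite addr_ge0 ?sqr_ge0].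
Qed.

(** Spending the share [1 - m] of all the dissipation on the cross terms works
    as soon as the sum [P + Q] of the two quotients is at most
    [(1 - m) ^+ 2 * g]. Since [(1 - m) ^+ 2 >= 1 - 2 * m], it suffices that
    [2 * m * g = g - (P + Q)]. *)
Lemma dissipation (R : realFieldType) (g r1 r2 l1 l2 i0 i1 w0 w1 : R) :
  0 < g -> 0 < r1 -> 0 < r2 ->
  l1 ^+ 2 * (i0 ^+ 2 + i1 ^+ 2) / (4 * r1)
    + l2 ^+ 2 * (w0 ^+ 2 + w1 ^+ 2) / (4 * r2) < g ->
  exists2 m : R, 0 < m & forall a b0 b1 c0 c1,
    - (g * a ^+ 2 + r1 * (b0 ^+ 2 + b1 ^+ 2) + r2 * (c0 ^+ 2 + c1 ^+ 2))
    + a * l1 * (b0 * i1 - b1 * i0) + a * l2 * (c0 * w1 - c1 * w0)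
    <= - m * (g * a ^+ 2 + r1 * (b0 ^+ 2 + b1 ^+ 2) + r2 * (c0 ^+ 2 + c1 ^+ 2)).
Proof.
move=> g0 r10 r20; set P := l1 ^+ 2 * _ / _; set Q := l2 ^+ 2 * _ / _ => PQ.
have quad_ge0 (l r x y : R) : 0 < r ->
    0 <= l ^+ 2 * (x ^+ 2 + y ^+ 2) / (4 * r).
  move=> r0; apply: divr_ge0; last by rewrite mulr_ge0// ltW.
  by rewrite mulr_ge0 ?addr_ge0 ?sqr_ge0.
have P0 : 0 <= P := quad_ge0 l1 r1 i0 i1 r10.
have Q0 : 0 <= Q := quad_ge0 l2 r2 w0 w1 r20.
pose m := (g - (P + Q)) / (2 * g).
have mg : m * (2 * g) = g - (P + Q) by rewrite divfK// gt_eqF// mulr_gt0.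
have m0 : 0 < m by rewrite divr_gt0 ?mulr_gt0// subr_gt0.
have m1 : 0 < 1 - m by nra.
exists m => // a b0 b1 c0 c1.
have HP := coupling_bound l1 a b0 b1 i0 i1 m1 r10.
have HQ := coupling_bound l2 a c0 c1 w0 w1 m1 r20.
have Ha : a ^+ 2 * P / (1 - m) + a ^+ 2 * Q / (1 - m) <= (1 - m) * (g * a ^+ 2).
  rewrite -mulrDl -mulrDr ler_pdivrMr//.
  rewrite [leRHS](_ : _ = a ^+ 2 * ((1 - m) ^+ 2 * g)); last by ring.
  apply: ler_wpM2l; first exact: sqr_ge0.
  have : 0 <= m ^+ 2 * g by rewrite mulr_ge0 ?sqr_ge0// ltW.
  nra.
rewrite -/P -/Q in HP HQ; lra.
Qed.

Section Stability.
Variables (R : realType) (p : params R) (s : 'cV[R]_2) (xs : state R).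

Definition energy (x : state R) : R :=
  C_dc p / 2 * (coord_vdc x - coord_vdc xs) ^+ 2
  + (L_ac p / 2 * (coord_idq 0 x - coord_idq 0 xs) ^+ 2
     + L_ac p / 2 * (coord_idq 1 x - coord_idq 1 xs) ^+ 2)
  + (C_ac p / 2 * (coord_vdq 0 x - coord_vdq 0 xs) ^+ 2
     + C_ac p / 2 * (coord_vdq 1 x - coord_vdq 1 xs) ^+ 2).

Lemma is_diff_energy x : is_diff x energy (fun h =>
  C_dc p / 2 * (2 * (coord_vdc x - coord_vdc xs) * coord_vdc h)
  + (L_ac p / 2 * (2 * (coord_idq 0 x - coord_idq 0 xs) * coord_idq 0 h)
     + L_ac p / 2 * (2 * (coord_idq 1 x - coord_idq 1 xs) * coord_idq 1 h))
  + (C_ac p / 2 * (2 * (coord_vdq 0 x - coord_vdq 0 xs) * coord_vdq 0 h)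
     + C_ac p / 2 * (2 * (coord_vdq 1 x - coord_vdq 1 xs) * coord_vdq 1 h))).
Proof.
have Dv := is_diff_weighted_square (C_dc p / 2) (coord_vdc xs)
  (is_diff_coord_vdc x).
have Di j := is_diff_weighted_square (L_ac p / 2) (coord_idq j xs)
  (is_diff_coord_idq j x).
have Dw j := is_diff_weighted_square (C_ac p / 2) (coord_vdq j xs)
  (is_diff_coord_vdq j x).
exact: is_diffD (is_diffD Dv (is_diffD (Di 0) (Di 1))) (is_diffD (Dw 0) (Dw 1)).
Qed.

Hypotheses (C_dc_gt0 : 0 < C_dc p) (G_dc_gt0 : 0 < G_dc p)
  (L_ac_gt0 : 0 < L_ac p) (R_ac_gt0 : 0 < R_ac p)
  (C_ac_gt0 : 0 < C_ac p) (G_ac_gt0 : 0 < G_ac p)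
  (eta_gt0 : 0 < eta p) (G_l_gt0 : 0 < G_l p) (K_p_gt0 : 0 < K_p p).
Hypothesis xs_steady : steady_state (closed_loop p s) xs.

(** Subtracting the steady-state equations leaves the dissipation and the work
    of the skew-symmetric terms against the values at [xs]; the couplings
    through [mu], [B_l] and between [i_dq] and [v_dq] cancel. *)
Lemma diff_energy_closed_loop x :
  let a := coord_vdc x - coord_vdc xs in
  let b j := coord_idq j x - coord_idq j xs in
  let c j := coord_vdq j x - coord_vdq j xs in
  'd energy x (closed_loop p s x) =
  - ((G_dc p + K_p p) * a ^+ 2 + R_ac p * (b 0 ^+ 2 + b 1 ^+ 2)
     + (G_ac p + G_l p) * (c 0 ^+ 2 + c 1 ^+ 2))
  + a * (eta p * L_ac p) * (b 0 * coord_idq 1 xs - b 1 * coord_idq 0 xs)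
  + a * (eta p * C_ac p) * (c 0 * coord_vdq 1 xs - c 1 * coord_vdq 0 xs).
Proof.
have D := is_diff_energy x.
rewrite (diff_val (is_diff_def := D)) => a b c.
have factor0 (q y : R) : 0 < q -> 0 = q^-1 * y -> y = 0.
  by move=> q0 /esym/eqP; rewrite mulf_eq0 invr_eq0 gt_eqF// => /eqP.
have ev : dc_current p xs = 0.
  by apply: (factor0 _ _ C_dc_gt0); rewrite -(closed_loop_vdc p s) xs_steady.
have idq0 j : 0 = coord_idq j (closed_loop p s xs).
  by rewrite xs_steady /coord_idq mxE.
have vdq0 j : 0 = coord_vdq j (closed_loop p s xs).
  by rewrite xs_steady /coord_vdq mxE.
have ei0 : inductor_voltage0 p xs = 0.
  by apply: (factor0 _ _ L_ac_gt0); rewrite -(closed_loop_idq0 p s).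
have ei1 : inductor_voltage1 p xs = 0.
  by apply: (factor0 _ _ L_ac_gt0); rewrite -(closed_loop_idq1 p s).
have ew0 : capacitor_current0 p s xs = 0.
  by apply: (factor0 _ _ C_ac_gt0); rewrite -(closed_loop_vdq0 p s).
have ew1 : capacitor_current1 p s xs = 0.
  by apply: (factor0 _ _ C_ac_gt0); rewrite -(closed_loop_vdq1 p s).
rewrite closed_loop_vdc closed_loop_idq0 closed_loop_idq1.
rewrite closed_loop_vdq0 closed_loop_vdq1.
transitivity (a * (dc_current p x - dc_current p xs)
   + (b 0 * (inductor_voltage0 p x - inductor_voltage0 p xs)
      + b 1 * (inductor_voltage1 p x - inductor_voltage1 p xs))
   + (c 0 * (capacitor_current0 p s x - capacitor_current0 p s xs)
      + c 1 * (capacitor_current1 p s x - capacitor_current1 p s xs))).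
  rewrite ev ei0 ei1 ew0 ew1 !subr0 /a /b /c.
  by field; rewrite !gt_eqF.
rewrite /dc_current /inductor_voltage0 /inductor_voltage1.
rewrite /capacitor_current0 /capacitor_current1 /a /b /c.
ring.
Qed.

Lemma sqr_euclidean_norm (u : 'cV[R]_2) :
  euclidean_norm u ^+ 2 = u 0 0 ^+ 2 + u 1 0 ^+ 2.
Proof.
rewrite /euclidean_norm sqr_sqrtr; last first.
  by apply: sumr_ge0 => i _; exact: sqr_ge0.
rewrite !big_ord_recl big_ord0 addr0; congr (_ + u _ _ ^+ 2); exact: val_inj.
Qed.

Lemma energy_coercive : exists2 a : R, 0 < a &
  forall x, a * `|x - xs| ^+ 2 <= energy x.
Proof.
pose a := Num.min (C_dc p / 2) (Num.min (L_ac p / 2) (C_ac p / 2)).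
have a0 : 0 < a by rewrite !lt_min !divr_gt0.
have [aC aL aC'] : [/\ a <= C_dc p / 2, a <= L_ac p / 2 & a <= C_ac p / 2].
  by rewrite /a !ge_min !lexx ?orbT.
exists a => // x.
have Ex0 : 0 <= energy x.
  by rewrite !addr_ge0// mulr_ge0 ?sqr_ge0// ltW// divr_gt0.
have coordE (l : state R -> R) : l (x - xs) = l x - l xs ->
    a * (l x - l xs) ^+ 2 <= energy x ->
    `|l (x - xs)| <= Num.sqrt (energy x / a).
  move=> -> le_E; rewrite -[leLHS]normr_id -sqrtr_sqr ler_wsqrtr//.
  by rewrite real_normK ?num_real// ler_pdivlMr// mulrC.
suff : `|x - xs| <= Num.sqrt (energy x / a).
  rewrite -(ler_pXn2r (_ : 0 < 2)%N) ?nnegrE ?sqrtr_ge0//.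
  by rewrite sqr_sqrtr ?divr_ge0 ?(ltW a0)// ler_pdivlMr// mulrC.
have sq (w y : R) : a <= w -> a * y ^+ 2 <= w * y ^+ 2.
  by move=> aw; rewrite ler_wpM2r ?sqr_ge0.
have sq0 (w y : R) : a <= w -> 0 <= w * y ^+ 2.
  by move=> aw; rewrite mulr_ge0 ?sqr_ge0// (le_trans (ltW a0)).
have v_ge0 := sq0 _ (coord_vdc x - coord_vdc xs) aC.
have i_ge0 j := sq0 _ (coord_idq j x - coord_idq j xs) aL.
have w_ge0 j := sq0 _ (coord_vdq j x - coord_vdq j xs) aC'.
move: (i_ge0 0) (i_ge0 1) (w_ge0 0) (w_ge0 1) => i0 i1 w0 w1.
apply: state_norm_le; first exact: sqrtr_ge0.
- apply: coordE => //; apply: le_trans (sq _ _ aC) _; rewrite /energy; lra.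
- move=> j; apply: coordE; first by rewrite /coord_idq /= !mxE.
  apply: le_trans (sq _ _ aL) _.
  by move: j; apply: ord2P; rewrite /energy; lra.
- move=> j; apply: coordE; first by rewrite /coord_vdq /= !mxE.
  apply: le_trans (sq _ _ aC') _.
  by move: j; apply: ord2P; rewrite /energy; lra.
Qed.

Hypothesis xs_cond :
  C_ac p ^+ 2 * euclidean_norm (v_dq xs) ^+ 2 / (4 * (G_ac p + G_l p))
  + L_ac p ^+ 2 * euclidean_norm (i_dq xs) ^+ 2 / (4 * R_ac p)
  < (G_dc p + K_p p) / eta p ^+ 2.

(** The rate [k] makes each term of the energy, multiplied by [k], at most [m]
    times the corresponding term of the dissipation. *)
Lemma energy_decay : exists2 k : R, 0 < k &
  forall x, 'd energy x (closed_loop p s x) <= - k * energy x.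
Proof.
have g0 : 0 < G_dc p + K_p p by rewrite addr_gt0.
have G0 : 0 < G_ac p + G_l p by rewrite addr_gt0.
have [|m m0 diss] := @dissipation R _ _ _ (eta p * L_ac p) (eta p * C_ac p)
    (coord_idq 0 xs) (coord_idq 1 xs) (coord_vdq 0 xs) (coord_vdq 1 xs)
    g0 R_ac_gt0 G0.
  move: xs_cond; rewrite !sqr_euclidean_norm ltr_pdivlMr ?exprn_gt0//.
  apply: le_lt_trans; rewrite le_eqVlt; apply/orP; left; apply/eqP.
  rewrite /coord_idq /coord_vdq !exprMn; field.
  by rewrite (gt_eqF R_ac_gt0) (gt_eqF G0).
pose k := 2 * m * Num.min ((G_dc p + K_p p) / C_dc p)
  (Num.min (R_ac p / L_ac p) ((G_ac p + G_l p) / C_ac p)).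
have k0 : 0 < k by rewrite !mulr_gt0// !lt_min !divr_gt0.
have m20 : 0 < 2 * m by rewrite mulr_gt0.
have k1 : k <= 2 * m * ((G_dc p + K_p p) / C_dc p).
  by rewrite ler_pM2l// ge_min lexx.
have k2 : k <= 2 * m * (R_ac p / L_ac p).
  by rewrite ler_pM2l// !ge_min lexx orbT.
have k3 : k <= 2 * m * ((G_ac p + G_l p) / C_ac p).
  by rewrite ler_pM2l// !ge_min lexx !orbT.
move: k k0 k1 k2 k3 => k k0 k1 k2 k3 {m20}.
exists k => // x; rewrite diff_energy_closed_loop.
apply: le_trans (diss _ _ _ _ _) _.
have kE (r c y : R) : 0 < c -> k <= 2 * m * (r / c) ->
    k * (c / 2 * y ^+ 2) <= m * (r * y ^+ 2).
  move=> c0 kr; rewrite [leLHS]mulrA [leRHS]mulrA ler_wpM2r ?sqr_ge0//.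
  have : k * c <= 2 * m * r by move: kr; rewrite mulrA ler_pdivlMr.
  lra.
rewrite !mulNr lerN2 /energy.
have := kE _ _ (coord_vdc x - coord_vdc xs) C_dc_gt0 k1.
have := kE _ _ (coord_idq 0 x - coord_idq 0 xs) L_ac_gt0 k2.
have := kE _ _ (coord_idq 1 x - coord_idq 1 xs) L_ac_gt0 k2.
have := kE _ _ (coord_vdq 0 x - coord_vdq 0 xs) C_ac_gt0 k3.
have := kE _ _ (coord_vdq 1 x - coord_vdq 1 xs) C_ac_gt0 k3.
lra.
Qed.

Lemma steady_state_globally_asymptotically_stable :
  globally_asymptotically_stable (closed_loop p s) xs.
Proof.
have [a a0 aE] := energy_coercive.
have [k k0 kE] := energy_decay.
apply: (@lyapunov_globally_asymptotically_stable _ _ _ energy _ k a) => //.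
- apply: cauchy_complete_prod; last exact: cauchy_complete_mx.
  by apply: cauchy_complete_prod; [exact: cauchy_completeR|
                                   exact: cauchy_complete_mx].
- apply: has_primitives_prod; last exact: has_primitives_mx.
  by apply: has_primitives_prod; [exact: has_primitivesR|
                                  exact: has_primitives_mx].
- exact: lipschitz_on_balls_closed_loop.
- by move=> z; have [] := is_diff_energy z.
- by rewrite /energy !subrr expr0n/= !mulr0 !addr0.
Qed.

End Stability.

Theorem corollary4 (R : realType) (p : params R)
    (C_dc_gt0 : 0 < C_dc p) (G_dc_gt0 : 0 < G_dc p)
    (L_ac_gt0 : 0 < L_ac p) (R_ac_gt0 : 0 < R_ac p)
    (C_ac_gt0 : 0 < C_ac p) (G_ac_gt0 : 0 < G_ac p)
    (eta_gt0 : 0 < eta p) (mu_ge0 : 0 <= mu p) (mu_le1 : mu p <= 1)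
    (G_l_gt0 : 0 < G_l p) (B_l_gt0 : 0 < B_l p) (K_p_gt0 : 0 < K_p p)
    (i_dc_ref_gt0 : 0 < i_dc_ref p) (v_dc_ref_gt0 : 0 < v_dc_ref p)
    (s_l : 'cV[R]_2) (xs : state R)
    (xs_steady : steady_state (closed_loop p s_l) xs)
    (xs_cond :
       C_ac p ^+ 2 * euclidean_norm (v_dq xs) ^+ 2 / (4 * (G_ac p + G_l p))
       + L_ac p ^+ 2 * euclidean_norm (i_dq xs) ^+ 2 / (4 * R_ac p)
       < (G_dc p + K_p p) / eta p ^+ 2) :
  (forall x : state R, steady_state (closed_loop p s_l) x -> x = xs) /\
  globally_asymptotically_stable (closed_loop p s_l) xs.
Proof.
have gas : globally_asymptotically_stable (closed_loop p s_l) xs.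
  exact: steady_state_globally_asymptotically_stable.
split=> // x; have [_ _ attractive] := gas.
exact: globally_attractive_unique attractive.
Qed.
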